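(* Let $\lambda\in(0,1)$. For any bijective map $\Phi:\mathbb{M}_{n}(\mathbb{C})\to\mathbb{M}_{n}(\mathbb{C})$ with $n\ge2$ (no linearity or continuity assumed), the following are equivalent: (i) $P_{\lambda}(\Phi(T)\Phi(S))=\Phi(P_{\lambda}(TS))$ for all $T,S\in\mathbb{M}_{n}(\mathbb{C})$. (ii) $P_{\lambda}(\Phi(T)\Phi(S))\sim_{u}\Phi(P_{\lambda}(TS))$ for all $T,S\in\mathbb{M}_{n}(\mathbb{C})$. (iii) There exists a unitary matrix $U\in\mathbb{M}_{n}(\mathbb{C})$ such that either $\Phi(T)=UTU^{*}$ for all $T\in\mathbb{M}_{n}(\mathbb{C})$, or $\Phi(T)=U\overline{T}U^{*}$ for all $T\in\mathbb{M}_{n}(\mathbb{C})$.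
   Context: $\mathbb{M}_{n}(\mathbb{C})$ is the set of $n\times n$ complex matrices; $\overline{T}$ is the entrywise complex conjugate of $T$. $A\sim_{u}B$ means there is a unitary $V$ with $A=VBV^{*}$. Every matrix $T$ has a unique polar decomposition $T=V|T|$, where $|T|=(T^{*}T)^{1/2}$ and $V$ is a partial isometry with $\mathcal{N}(V)=\mathcal{N}(T)$. The Duggal transform is $T^{D}=|T|V$, the Aluthge transform is $\Delta(T)=|T|^{1/2}V|T|^{1/2}$, and the power mean transform is $P_{\lambda}(T)=(1-\lambda)^2T+\lambda^2T^{D}+2\lambda(1-\lambda)\Delta(T)$. *)

(* Defs.v *)
From HB Require Import structures.
From mathcomp Require Import all_boot all_order all_algebra.
From mathcomp Require Import sesquilinear spectral.
From mathcomp Require Import boolp classical_sets.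

Set Implicit Arguments.
Unset Strict Implicit.
Unset Printing Implicit Defensive.

Import Order.TTheory GRing.Theory Num.Theory Num.Def.

Local Open Scope ring_scope.
Local Open Scope sesquilinear_scope.

Section Definitions.
Context {C : numClosedFieldType} {n : nat}.
Implicit Types (A B S T V : 'M[C]_n) (x y : 'cV[C]_n).

Definition psdmx A : Prop :=
  A \is hermsymmx /\ forall x, 0 <= (x^t* *m A *m x) 0 0.

(* The positive semidefinite square root; by [sqrtmxP] and [sqrtmx_unique] the
   default value 0 of [xget] is never used when [A] is positive semidefinite. *)
Definition sqrtmx A : 'M[C]_n :=
  xget 0 [set S : 'M[C]_n | psdmx S /\ S *m S = A].

Definition absmx T : 'M[C]_n := sqrtmx (T^t* *m T).

(* [V] is isometric on the orthogonal complement of its kernel. *)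
Definition partial_isometry V : Prop :=
  forall x, (forall y, V *m y = 0 -> y^t* *m x = 0) ->
    (V *m x)^t* *m (V *m x) = x^t* *m x.

Definition polar_decomposition T V : Prop :=
  [/\ T = V *m absmx T, partial_isometry V
    & forall x, V *m x = 0 <-> T *m x = 0].

(* The default value 0 of [xget] is never used: see [polar_isometryP] and
   [polar_isometry_unique]. *)
Definition polar_isometry T : 'M[C]_n :=
  xget 0 [set V : 'M[C]_n | polar_decomposition T V].

Definition duggal T : 'M[C]_n := absmx T *m polar_isometry T.

Definition aluthge T : 'M[C]_n :=
  sqrtmx (absmx T) *m polar_isometry T *m sqrtmx (absmx T).

Definition power_mean (lambda : C) T : 'M[C]_n :=
  (1 - lambda) ^+ 2 *: T + lambda ^+ 2 *: duggal T
  + (2 * lambda * (1 - lambda)) *: aluthge T.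

Definition unitarily_similar A B : Prop :=
  exists2 V, V \is unitarymx & A = V *m B *m V^t*.

End Definitions.

Section Facts.
Context {C : numClosedFieldType}.

Lemma trmxC_mul m n p (A : 'M[C]_(m, n)) (B : 'M[C]_(n, p)) :
  (A *m B)^t* = B^t* *m A^t*.
Proof. by rewrite trmx_mul map_mxM. Qed.

Lemma hermsymmxE n (A : 'M[C]_n) : (A \is hermsymmx) = (A == A^t*).
Proof. by rewrite is_hermitianmxE expr0 scale1r. Qed.

Lemma trmxC_diag n (d : 'rV[C]_n) : (forall j, 0 <= d 0 j) ->
  (diag_mx d)^t* = diag_mx d.
Proof.
move=> d0; apply/matrixP => i j; rewrite !mxE eq_sym.
case: eqP => [->|_]; last by rewrite !mulr0n rmorph0.
by rewrite !mulr1n; apply/CrealP/ger0_real.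
Qed.

Lemma dotcol_ge0 n (x : 'cV[C]_n) : 0 <= (x^t* *m x) 0 0.
Proof.
by rewrite mxE sumr_ge0 // => i _; rewrite !mxE mulrC mul_conjC_ge0.
Qed.

Lemma trmxC_mul_eq0 m n (A : 'M[C]_(m, n)) : A^t* *m A = 0 -> A = 0.
Proof.
move=> A0; apply/matrixP => i j; rewrite mxE.
have /eqP := congr1 (fun M : 'M_n => M j j) A0.
rewrite !mxE psumr_eq0 => [/allP/(_ i)|k _]; last first.
  by rewrite !mxE mulrC mul_conjC_ge0.
by rewrite mem_index_enum !mxE mulrC mul_conjC_eq0 => /(_ isT)/eqP.
Qed.

Lemma psdmxP n (A : 'M[C]_n) : psdmx A <->
  exists P (d : 'rV[C]_n), [/\ P \is unitarymx, forall j, 0 <= d 0 j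
    & A = P^t* *m diag_mx d *m P].
Proof.
split=> [[Ah A0]|[P [d [PU d0 ->]]]].
  have /orthomx_spectralP := hermitian_normalmx Ah.
  set P := spectralmx A; set d := spectral_diag A.
  have PU : P \is unitarymx by exact: spectral_unitarymx.
  rewrite invmx_unitary // => AE; exists P, d; split=> // j.
  have := A0 (P^t* *m delta_mx j 0).
  rewrite AE trmxC_mul trmxCK !mulmxA (mulmxtVK _ PU) -!mulmxA.
  rewrite [P *m (_ *m _)]mulmxA (unitarymxP PU) mul1mx mul_diag_mx.
  rewrite mxE (bigD1 j) //= big1 => [|i /negPf ij].
    by rewrite !mxE !eqxx rmorph1 mul1r mulr1 addr0.
  by rewrite !mxE ij mulr0 mulr0.
split=> [|x]; first by rewrite hermsymmxE !trmxC_mul trmxCK trmxC_diag // mulmxA.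
rewrite !mulmxA -trmxC_mul -mulmxA mul_mx_diag mxE sumr_ge0 // => i _.
by rewrite !mxE mulrAC mulr_ge0 // mulrC mul_conjC_ge0.
Qed.

Lemma sqrtmx_unique n (S S' : 'M[C]_n) :
  psdmx S -> psdmx S' -> S *m S = S' *m S' -> S = S'.
Proof.
move=> /psdmxP[P [d [PU d0 ->]]] /psdmxP[Q [e [QU e0 ->]]].
rewrite !mulmxA !(mulmxtVK _ PU) !(mulmxtVK _ QU).
rewrite -![_ *m diag_mx _ *m diag_mx _]mulmxA => E.
set M := P *m Q^t*.
have E2 : diag_mx d *m diag_mx d *m M = M *m (diag_mx e *m diag_mx e).
  have := congr1 (fun X => P *m X *m Q^t*) E.
  by rewrite !mulmxA (unitarymxP PU) mul1mx (mulmxtVK _ QU) -!mulmxA.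
suff E1 : diag_mx d *m M = M *m diag_mx e.
  have /unitarymxP : P^t* \is unitarymx by rewrite trmxC_unitary.
  rewrite trmxCK => PP; have := congr1 (fun X => P^t* *m X *m Q) E1.
  by rewrite /M !mulmxA PP mul1mx (mulmxKtV _ QU).
clearbody M; apply/matrixP => i j; have /matrixP/(_ i j) := E2.
rewrite !mulmx_diag !(mul_diag_mx, mul_mx_diag) !mxE.
set m := M i j; have [->|m0] := eqVneq m 0; first by rewrite !mulr0 !mul0r.
rewrite mulrA mulrC -mulrA => /(mulfI m0)/eqP.
by rewrite -!expr2 eqrXn2 // => /eqP ->; rewrite mulrC.
Qed.

Lemma sqrtmxP n (A : 'M[C]_n) : psdmx A ->
  psdmx (sqrtmx A) /\ sqrtmx A *m sqrtmx A = A.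
Proof.
move=> /psdmxP[P [d [PU d0 ->]]].
apply: (@xgetPex _ 0
  [set S : 'M[C]_n | psdmx S /\ S *m S = P^t* *m diag_mx d *m P]).
exists (P^t* *m diag_mx (map_mx sqrtC d) *m P); split.
  by apply/psdmxP; exists P, (map_mx sqrtC d); split=> // j; rewrite mxE sqrtC_ge0.
rewrite !mulmxA (mulmxtVK _ PU) -[_ *m diag_mx _ *m diag_mx _]mulmxA mulmx_diag.
congr (_ *m diag_mx _ *m _); apply/rowP => j.
by rewrite !mxE -expr2 sqrtCK.
Qed.

Lemma psdmx_gram n (T : 'M[C]_n) : psdmx (T^t* *m T).
Proof.
split=> [|x]; first by rewrite hermsymmxE trmxC_mul trmxCK.
by rewrite mulmxA -trmxC_mul -mulmxA dotcol_ge0.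
Qed.

Lemma absmxP n (T : 'M[C]_n) :
  psdmx (absmx T) /\ absmx T *m absmx T = T^t* *m T.
Proof. exact: sqrtmxP (psdmx_gram T). Qed.

(* [Q] is the orthogonal projection onto the range of |T|, and [S] the
   Moore-Penrose inverse of |T|. *)
Lemma absmx_pinv n (T : 'M[C]_n) : exists S Q : 'M[C]_n,
  [/\ absmx T *m S = Q, S^t* *m (T^t* *m T) *m S = Q, T *m Q = T,
      S *m absmx T = Q /\ S *m Q = S
    & forall x : 'cV[C]_n, T *m x = 0 -> S *m x = 0].
Proof.
have [/psdmxP[P [d [PU d0 AE]]] AA] := absmxP T.
pose e : 'rV[C]_n := map_mx (fun a => a^-1) d.
have e0 j : 0 <= e 0 j by rewrite mxE invr_ge0.
pose S := P^t* *m diag_mx e *m P.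
pose Q := P^t* *m (diag_mx d *m diag_mx e) *m P.
have dede : diag_mx d *m diag_mx e *m (diag_mx d *m diag_mx e)
    = diag_mx d *m diag_mx e.
  rewrite !mulmx_diag; congr diag_mx; apply/rowP => j; rewrite !mxE.
  by have [->|dj] := eqVneq (d 0 j) 0; rewrite ?mul0r // divff // mulr1.
have AS : absmx T *m S = Q.
  by rewrite AE /S /Q !mulmxA (mulmxtVK _ PU).
have SA : S *m absmx T = Q.
  rewrite AE /S /Q !mulmxA (mulmxtVK _ PU) -[_ *m diag_mx e *m _]mulmxA.
  by rewrite diag_mxC !mulmxA.
have Sh : S^t* = S.
  by rewrite /S !trmxC_mul trmxCK trmxC_diag // mulmxA.
have QQ : Q *m Q = Q.
  by rewrite -[in RHS]/Q /Q -{3}dede !mulmxA (mulmxtVK _ PU).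
have AQ : absmx T *m Q = absmx T.
  rewrite AE /Q !mulmxA (mulmxtVK _ PU) -!mulmxA; congr (_ *m _).
  rewrite !mulmxA !mulmx_diag; congr (diag_mx _ *m _); apply/rowP => j.
  rewrite !mxE.
  by have [->|dj] := eqVneq (d 0 j) 0; rewrite ?mul0r // mulfK.
have SQ : S *m Q = S.
  rewrite /S /Q !mulmxA (mulmxtVK _ PU) -!mulmxA; congr (_ *m _).
  rewrite !mulmxA !mulmx_diag; congr (diag_mx _ *m _); apply/rowP => j.
  rewrite !mxE; have [->|dj] := eqVneq (d 0 j) 0; first by rewrite invr0 !mul0r.
  by rewrite mulVf // mul1r.
clearbody S Q; exists S, Q; split=> //.
- by rewrite Sh -AA !mulmxA SA -[Q *m _ *m S]mulmxA AS QQ.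
- apply/eqP; rewrite -subr_eq0 -{2}[T]mulmx1 -mulmxBr; apply/eqP.
  apply: trmxC_mul_eq0; rewrite trmxC_mul !mulmxA -[_ *m T^t* *m T]mulmxA -AA.
  by rewrite -!mulmxA mulmxBr AQ mulmx1 subrr !mulmx0.
- move=> x Tx0; have -> : S = S *m S *m S *m (T^t* *m T).
    rewrite -AA !mulmxA -[_ *m S *m absmx T]mulmxA SA.
    by rewrite -[_ *m S *m Q]mulmxA SQ -[_ *m S *m absmx T]mulmxA SA SQ.
  by rewrite -!mulmxA Tx0 !mulmx0.
Qed.

Lemma polar_isometryP n (T : 'M[C]_n) :
  polar_decomposition T (polar_isometry T).
Proof.
apply: (@xgetPex _ 0 [set V : 'M[C]_n | polar_decomposition T V]).
have [S [Q [AS STS TQ [SA SQ] kS]]] := absmx_pinv T.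
have VV : (T *m S)^t* *m (T *m S) = Q by rewrite trmxC_mul !mulmxA -STS !mulmxA.
have Qh : Q^t* = Q by rewrite -VV [LHS]trmxC_mul trmxCK.
exists (T *m S); split.
- by rewrite -mulmxA SA TQ.
- move=> x xV; rewrite trmxC_mul mulmxA -[_ *m _ *m (T *m S)]mulmxA VV.
  have : (x - Q *m x)^t* *m x = 0.
    by apply: xV; rewrite mulmxBr mulmxA -[T *m S *m Q]mulmxA SQ subrr.
  rewrite linearB /= map_mxB mulmxBl trmxC_mul Qh => /eqP.
  by rewrite subr_eq0 => /eqP.
- move=> x; split=> [Vx|Tx]; last by rewrite -mulmxA kS // mulmx0.
  by rewrite -TQ -VV -mulmxA -mulmxA Vx !mulmx0.
Qed.

Lemma polar_isometry_unique n (T V : 'M[C]_n) :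
  polar_decomposition T V -> V = polar_isometry T.
Proof.
have [S [Q [AS _ TQ _ _]]] := absmx_pinv T.
suff VE W : polar_decomposition T W -> W = T *m S.
  by move=> /VE ->; rewrite (VE _ (polar_isometryP T)).
move=> [TE _ kW]; rewrite [in RHS]TE -mulmxA AS.
apply/eqP; rewrite -subr_eq0 -{1}[W]mulmx1 -mulmxBr; apply/eqP.
apply/matrixP => i j.
have /colP/(_ i) : col j (W *m (1%:M - Q)) = 0.
  by rewrite colE -mulmxA; apply/kW; rewrite mulmxA mulmxBr mulmx1 TQ subrr mul0mx.
by rewrite !mxE.
Qed.

End Facts.

(* Main.v *)
Require Import Defs.
From HB Require Import structures.
From mathcomp Require Import all_boot all_order all_algebra.
From mathcomp Require Import sesquilinear spectral complex reals boolp ring.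

Import Order.TTheory GRing.Theory Num.Theory Num.Def.
Local Open Scope ring_scope.
Local Open Scope sesquilinear_scope.

(* Write P for the power mean transform.  It preserves traces, P(T) = 0 forces
   T = 0, and for a unit vector y and k = (1 - l)^2,
     P(x y^* ) = k x y^* + (1 - k) <y, x> y y^*.
   Let Phi satisfy (ii).  Then Phi preserves zero products in both directions,
   hence matrices of rank at most one, and it maps rank one projections to rank
   one projections.  Comparing traces, there is a function h with
     tr (Phi(T) Phi(Y)) = h (tr (T Y)) for all T and all Y of rank at most one.
   Testing with Y = E_ji in the orthonormal basis given by the projections
   Phi(E_ii), this determines the entries of Phi(T): up to a unitary similarity,
   Phi applies h entrywise.  The trace identity makes h a ring morphism as soon
   as n >= 2, and h commutes with conjugation because Phi(p) is Hermitian for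
   rank one projections p; so h is the identity or the conjugation. *)

(** * Square roots, polar isometries and the power mean transform *)

Section ConjugateTranspose.
Set Implicit Arguments.
Unset Strict Implicit.
Context {C : numClosedFieldType}.

Lemma trmxCZ m n (c : C) (A : 'M[C]_(m, n)) : (c *: A)^t* = c^* *: A^t*.
Proof. by rewrite linearZ /= map_mxZ. Qed.

Lemma trmxCD m n (A B : 'M[C]_(m, n)) : (A + B)^t* = A^t* + B^t*.
Proof. by rewrite linearD /= map_mxD. Qed.

Lemma trmxC1 n : (1%:M : 'M[C]_n)^t* = 1%:M.
Proof. by rewrite trmx1 map_mx1. Qed.

Lemma unitarymx_trmxCK n (U : 'M[C]_n) : U \is unitarymx -> U^t* *m U = 1%:M.
Proof.
by rewrite -trmxC_unitary => /unitarymxP; rewrite trmxCK.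
Qed.

(** A Gram factorization involves only products and adjoints, so it passes through every
    multiplicative map that commutes with [^t*]. *)
Lemma psdmx_gramP n (A : 'M[C]_n) : psdmx A <-> exists B : 'M_n, A = B^t* *m B.
Proof.
split=> [/sqrtmxP[[Sh _] SS]|[B ->]]; last exact: psdmx_gram.
by exists (sqrtmx A); move: Sh; rewrite hermsymmxE => /eqP <-.
Qed.

Lemma psdmx_herm n (A : 'M[C]_n) : psdmx A -> A^t* = A.
Proof. by case; rewrite hermsymmxE => /eqP. Qed.

Lemma sqrtmx_eq n (A S : 'M[C]_n) : psdmx S -> S *m S = A -> sqrtmx A = S.
Proof.
move=> Sp SA; have /sqrtmxP[Rp RA] : psdmx A.
  by rewrite -SA -{1}(psdmx_herm Sp); apply: psdmx_gram.
by apply: sqrtmx_unique; rewrite ?RA ?SA.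
Qed.

Lemma absmx_herm n (T : 'M[C]_n) : (absmx T)^t* = absmx T.
Proof. by apply: psdmx_herm; case: (absmxP T). Qed.

Lemma polar_isometry_ker m n (T : 'M[C]_n) (M : 'M_(n, m)) :
  T *m M = 0 -> polar_isometry T *m M = 0.
Proof.
have [_ _ kV] := polar_isometryP T.
move=> TM; apply/matrixP => i j.
have /colP/(_ i) : col j (polar_isometry T *m M) = 0.
  rewrite colE -mulmxA; apply/kV; rewrite mulmxA TM mul0mx //.
by rewrite !mxE.
Qed.

(** An algebraic form of the kernel condition: the polar isometry vanishes on the kernel of T, hence
    is unchanged by the projection [Q], and [Q = S *m absmx T]. *)
Lemma polar_isometry_factor n (T : 'M[C]_n) :
  exists X, polar_isometry T = X *m absmx T.
Proof.
have [S [Q [_ _ TQ [SA _] _]]] := absmx_pinv T.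
exists (polar_isometry T *m S); rewrite -mulmxA SA.
apply/eqP; rewrite eq_sym -subr_eq0 -{2}[polar_isometry T]mulmx1 -mulmxBr.
by rewrite polar_isometry_ker // mulmxBr TQ mulmx1 subrr.
Qed.

Lemma polar_isometry_absmx n (T : 'M[C]_n) : polar_isometry T *m absmx T = T.
Proof. by have [<-] := polar_isometryP T. Qed.

(** Both candidates have |T| as a right factor. Their difference N = (Y - X)|T| satisfies N|T| = 0,
    so N times its adjoint is 0. *)
Lemma polar_isometry_eq n (T V X : 'M[C]_n) :
  V *m absmx T = T -> V = X *m absmx T -> polar_isometry T = V.
Proof.
move=> VT VX; have [Y YE] := polar_isometry_factor T.
apply/eqP; rewrite -subr_eq0; apply/eqP.
have E : (Y - X) *m absmx T *m absmx T = 0.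
  by rewrite mulmxBl mulmxBl -VX VT -YE polar_isometry_absmx subrr.
rewrite YE VX -mulmxBl -[LHS]trmxCK.
suff -> : ((Y - X) *m absmx T)^t* = 0 by rewrite trmx0 map_mx0.
by apply: trmxC_mul_eq0; rewrite trmxCK trmxC_mul absmx_herm mulmxA E mul0mx.
Qed.

Lemma power_mean0 n (l : C) : power_mean l (0 : 'M_n) = 0.
Proof.
have V0 : polar_isometry (0 : 'M[C]_n) = 0.
  by rewrite -[LHS]mulmx1 polar_isometry_ker // mul0mx.
rewrite /power_mean /duggal /aluthge V0 !(mulmx0, mul0mx) !scaler0.
by rewrite !addr0.
Qed.

(** By cyclicity the three terms have the same trace, and their weights add up to ((1 - l) + l)^2 =
    1. *)
Lemma mxtrace_power_mean n (l : C) (T : 'M[C]_n) : \tr (power_mean l T) = \tr T.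
Proof.
have [_ SS] := sqrtmxP (absmxP T).1.
rewrite /power_mean !linearD !linearZ /= /duggal /aluthge.
rewrite (mxtrace_mulC (absmx T)) polar_isometry_absmx.
rewrite mxtrace_mulC mulmxA (mxtrace_mulC _ (polar_isometry T)) SS.
rewrite polar_isometry_absmx; ring.
Qed.

(* In an eigenbasis of |T|, where |T| = diag(s_i^2), the (i, j) entry of P(T)
   is ((1 - l) s_j + l s_i)^2 times that of the polar isometry. *)
Lemma power_mean_eq0 n (l : C) (T : 'M[C]_n) :
  0 <= l -> l < 1 -> power_mean l T = 0 -> T = 0.
Proof.
move=> l0 l1; have [Ap _] := absmxP T.
have /psdmxP[P [s [PU s0 SE]]] := (sqrtmxP Ap).1.
have AE : absmx T = P^t* *m (diag_mx s *m diag_mx s) *m P.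
  by rewrite -(sqrtmxP Ap).2 SE !mulmxA (mulmxtVK _ PU).
set W := P *m polar_isometry T *m P^t*.
have TE : T = P^t* *m (W *m (diag_mx s *m diag_mx s)) *m P.
  rewrite -{1}(polar_isometry_absmx T) AE /W !mulmxA.
  by rewrite (unitarymx_trmxCK PU) mul1mx.
have VE : polar_isometry T = P^t* *m W *m P.
  by rewrite /W !mulmxA (unitarymx_trmxCK PU) mul1mx (mulmxKtV _ PU).
clearbody W; rewrite /power_mean /duggal /aluthge => PT0.
have {PT0} := congr1 (fun X => P *m X *m P^t*) PT0.
rewrite /= {1}TE VE SE AE mulmx_diag mulmx0 mul0mx.
rewrite !mulmxDr !mulmxDl -!scalemxAr -!scalemxAl !mulmxA !(mulmxtVK _ PU).
rewrite (unitarymxP PU) !mul1mx => E.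
rewrite TE; suff -> : W *m (diag_mx s *m diag_mx s) = 0.
  by rewrite mulmx0 mul0mx.
apply/matrixP => i j; have /matrixP/(_ i j) := E.
rewrite mulmx_diag !(mul_diag_mx, mul_mx_diag) !mxE.
have [->|sj] := eqVneq (s 0 j) 0; first by rewrite !mulr0.
rewrite (_ : _ + _ = W i j * ((1 - l) * s 0 j + l * s 0 i) ^+ 2); last by ring.
move=> /eqP; rewrite mulf_eq0 => /orP[/eqP->|]; first by rewrite !mul0r.
(* The base of the square is positive, because s_j > 0 and l < 1. *)
rewrite expf_eq0 /= gt_eqF // ltr_wpDr // ?mulr_ge0 //.
by rewrite mulr_gt0 ?subr_gt0 // lt_def sj s0.
Qed.

(* Square roots and polar isometries are characterized by identities that
   any multiplicative map commuting with [^t*] transports. *)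
Lemma power_mean_morph n (l : C) (f : 'M[C]_n -> 'M[C]_n) :
  l \is Num.real -> {morph f : A B / A *m B} -> {morph f : A / A^t*} ->
  {morph f : A B / A + B} -> (forall c A, c \is Num.real -> f (c *: A) = c *: f A) ->
  {morph f : T / power_mean l T}.
Proof.
move=> lR fM fC fD fZ T.
have fpsd A : psdmx A -> psdmx (f A).
  by move=> /psdmx_gramP[B ->]; rewrite fM fC; apply: psdmx_gram.
have fabs : absmx (f T) = f (absmx T).
  have [Ap AE] := absmxP T; apply: sqrtmx_eq; first exact: fpsd.
  by rewrite -fM AE fM fC.
have fsqrt : sqrtmx (f (absmx T)) = f (sqrtmx (absmx T)).
  have [Sp SE] := sqrtmxP (absmxP T).1; apply: sqrtmx_eq; first exact: fpsd.
  by rewrite -fM SE.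
have fV : polar_isometry (f T) = f (polar_isometry T).
  have [X XE] := polar_isometry_factor T.
  apply: (@polar_isometry_eq _ _ _ (f X)); rewrite fabs -fM -?XE //.
  by rewrite polar_isometry_absmx.
rewrite /power_mean /duggal /aluthge fabs fsqrt fV -!fM !fD !fZ //;
  by rewrite ?(rpredX, rpredM, rpredB, rpred1, realn).
Qed.
End ConjugateTranspose.

(** * Matrices of rank at most one and their power means *)

Section OuterProducts.
Set Implicit Arguments.
Unset Strict Implicit.
Context {C : numClosedFieldType} {n : nat}.
Implicit Types (x y u v : 'cV[C]_n) (A : 'M[C]_n) (c : C).

Definition dot x y : C := (x^t* *m y) 0 0.
Definition outer x y : 'M[C]_n := x *m y^t*.
Definition rank_le1 A : Prop := exists x y, A = outer x y.

Lemma dot_scalar x y : x^t* *m y = (dot x y)%:M.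
Proof. exact: mx11_scalar. Qed.

Lemma dotC x y : dot x y = (dot y x)^*.
Proof. by rewrite /dot -{1}[y]trmxCK -trmxC_mul !mxE. Qed.

Lemma dotDr x y u : dot x (y + u) = dot x y + dot x u.
Proof. by rewrite /dot mulmxDr mxE. Qed.

Lemma dotDl x y u : dot (x + y) u = dot x u + dot y u.
Proof. by rewrite /dot trmxCD mulmxDl mxE. Qed.

Lemma dotZr x c y : dot x (c *: y) = c * dot x y.
Proof. by rewrite /dot -scalemxAr mxE. Qed.

Lemma dotZl x c y : dot (c *: x) y = c^* * dot x y.
Proof. by rewrite /dot trmxCZ -scalemxAl mxE. Qed.

Lemma dot_ge0 x : 0 <= dot x x.
Proof. exact: dotcol_ge0. Qed.

Lemma dot_eq0 x : dot x x = 0 -> x = 0.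
Proof.
by move=> x0; apply: trmxC_mul_eq0; rewrite dot_scalar x0 raddf0.
Qed.

Lemma dot_gt0 x : x != 0 -> 0 < dot x x.
Proof.
move=> x0; rewrite lt_def dot_ge0 andbT; apply: contra x0 => /eqP.
by move=> /dot_eq0 ->.
Qed.

Lemma unit_normalize x : x != 0 ->
  exists c u, [/\ 0 < c, dot u u = 1 & x = c *: u].
Proof.
move=> /dot_gt0 xx; set c := sqrtC (dot x x).
have c0 : 0 < c by rewrite sqrtC_gt0.
exists c, (c^-1 *: x); rewrite scalerA divff ?gt_eqF // scale1r; split=> //.
rewrite dotZl dotZr conj_Creal ?gtr0_real ?invr_gt0 // -[dot x x]sqrtCK -/c.
by field; rewrite gt_eqF.
Qed.

Lemma mul_outer_col x y u : outer x y *m u = dot y u *: x.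
Proof. by rewrite /outer -mulmxA dot_scalar mul_mx_scalar. Qed.

Lemma mul_outer x y u v : outer x y *m outer u v = dot y u *: outer x v.
Proof. by rewrite {2}/outer mulmxA mul_outer_col -scalemxAl. Qed.

Lemma trmxC_outer x y : (outer x y)^t* = outer y x.
Proof. by rewrite trmxC_mul trmxCK. Qed.

Lemma mxtrace_outer x y : \tr (outer x y) = dot y x.
Proof. by rewrite /outer mxtrace_mulC dot_scalar mxtrace_scalar. Qed.

Lemma outerDl x y u : outer (x + y) u = outer x u + outer y u.
Proof. exact: mulmxDl. Qed.

Lemma outerZl c x y : outer (c *: x) y = c *: outer x y.
Proof. by rewrite /outer scalemxAl. Qed.

Lemma outerZr c x y : outer x (c *: y) = c^* *: outer x y.
Proof. by rewrite /outer trmxCZ scalemxAr. Qed.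

Lemma outer0l y : outer 0 y = 0. Proof. exact: mul0mx. Qed.

Lemma unit_neq0 x : dot x x = 1 -> x != 0.
Proof.
by apply: contra_eq_neq => ->; rewrite /dot mulmx0 mxE eq_sym oner_eq0.
Qed.

Lemma rank_le1_unit A : A != 0 -> rank_le1 A ->
  exists x y, dot y y = 1 /\ A = outer x y.
Proof.
move=> A0 [x [y AE]]; have y0 : y != 0.
  by apply: contra A0 => /eqP y0; rewrite AE y0 /outer trmx0 map_mx0 mulmx0.
have [c [u [c0 uu yE]]] := unit_normalize y0.
by exists (c^* *: x), u; split=> //; rewrite AE yE outerZr outerZl.
Qed.

Lemma rank_le1_mull A X : rank_le1 X -> rank_le1 (A *m X).
Proof. by move=> [x [y ->]]; exists (A *m x), y; rewrite /outer mulmxA. Qed.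

(** For T = x y^* with x nonzero, q = y y^* and a the norm of x, |T| = a q and the polar isometry is
    T / a. The Duggal and Aluthge transforms then both equal <y, x> q. *)
Lemma power_mean_outer (l : C) x y : dot y y = 1 ->
  power_mean l (outer x y) =
    (1 - l) ^+ 2 *: outer x y + ((1 - (1 - l) ^+ 2) * dot y x) *: outer y y.
Proof.
move=> yy; have [->|x0] := eqVneq x 0.
  by rewrite outer0l power_mean0 scaler0 /dot mulmx0 mxE mulr0 scale0r addr0.
set q := outer y y; set a := sqrtC (dot x x); set b := sqrtC a.
have a0 : 0 < a by rewrite sqrtC_gt0 dot_gt0.
have b0 : 0 < b by rewrite sqrtC_gt0.
have qq : q *m q = q by rewrite mul_outer yy scale1r.
have qpsd c : 0 <= c -> psdmx (c *: q).
  move=> c0; apply/psdmx_gramP; exists (sqrtC c *: q).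
  rewrite trmxCZ trmxC_outer -scalemxAl -scalemxAr qq scalerA.
  by rewrite conj_Creal ?ger0_real ?sqrtC_ge0 // -expr2 sqrtCK.
have absE : absmx (outer x y) = a *: q.
  apply: sqrtmx_eq; first exact/qpsd/ltW.
  rewrite -scalemxAl -scalemxAr qq scalerA trmxC_outer mul_outer.
  by rewrite -expr2 sqrtCK.
have sqrtE : sqrtmx (absmx (outer x y)) = b *: q.
  rewrite absE; apply: sqrtmx_eq; first exact/qpsd/ltW.
  by rewrite -scalemxAl -scalemxAr qq scalerA -expr2 sqrtCK.
have VE : polar_isometry (outer x y) = a^-1 *: outer x y.
  apply: (@polar_isometry_eq _ _ _ _ (a^-1 *: (a^-1 *: outer x y))).
    rewrite absE -scalemxAl -scalemxAr mul_outer yy !scalerA mulr1.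
    by rewrite mulVf ?gt_eqF // scale1r.
  rewrite absE -!scalemxAl -scalemxAr mul_outer yy !scalerA mulr1.
  by rewrite -mulrA mulVf ?gt_eqF // mulr1.
rewrite /power_mean /duggal /aluthge sqrtE absE VE.
rewrite -!(scalemxAl, scalemxAr) !mul_outer -!scalemxAl mul_outer yy !scalerA.
rewrite -addrA -scalerDl; congr (_ + _ *: _).
rewrite -[a]sqrtCK -/b.
by field; rewrite gt_eqF.
Qed.

Lemma power_mean_rank_le1 (l : C) A : rank_le1 A -> rank_le1 (power_mean l A).
Proof.
move=> A1; have [A0|A0] := eqVneq A 0.
  by rewrite A0 power_mean0; exists 0, 0; rewrite outer0l.
have [x [y [yy ->]]] := rank_le1_unit A0 A1.
rewrite power_mean_outer // -!outerZl -outerDl.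
by exists ((1 - l) ^+ 2 *: x + ((1 - (1 - l) ^+ 2) * dot y x) *: y), y.
Qed.

(** These fixed points of P let the right-hand side of (ii) be evaluated. *)
Lemma power_mean_proj (l : C) c x :
  dot x x = 1 -> power_mean l (c *: outer x x) = c *: outer x x.
Proof.
move=> xx; rewrite -outerZl power_mean_outer // dotZr xx outerZl scalerA.
by rewrite -scalerDl; congr (_ *: _); ring.
Qed.
End OuterProducts.

(** * Invariants of unitary similarity: trace and Frobenius norm *)

Section UnitarilySimilar.
Set Implicit Arguments.
Unset Strict Implicit.
Context {C : numClosedFieldType} {n : nat}.
Implicit Types A B : 'M[C]_n.

Lemma unitarily_similar_sym A B : unitarily_similar A B -> unitarily_similar B A.
Proof.
move=> [V VU ->]; exists (V^t*); first by rewrite trmxC_unitary.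
rewrite trmxCK !mulmxA unitarymx_trmxCK // mul1mx -mulmxA.
by rewrite unitarymx_trmxCK ?mulmx1.
Qed.

Lemma unitarily_similar0 A : unitarily_similar A 0 -> A = 0.
Proof. by move=> [V _ ->]; rewrite mulmx0 mul0mx. Qed.

Lemma unitarily_similar_tr A B : unitarily_similar A B -> \tr A = \tr B.
Proof.
by move=> [V VU ->]; rewrite mxtrace_mulC mulmxA unitarymx_trmxCK // mul1mx.
Qed.

Lemma unitarily_similar_gram A B :
  unitarily_similar A B -> \tr (A^t* *m A) = \tr (B^t* *m B).
Proof.
move=> [V VU ->]; apply: unitarily_similar_tr; exists V => //.
rewrite !trmxC_mul trmxCK !mulmxA -[_ *m V^t* *m V]mulmxA.
by rewrite unitarymx_trmxCK // mulmx1.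
Qed.
End UnitarilySimilar.

(** * Zero products, rank one matrices and traces under Phi *)

Section MeanPreserver.
Set Implicit Arguments.
Unset Strict Implicit.
Context {C : numClosedFieldType} {n : nat} {l : C} {Phi : 'M[C]_n -> 'M[C]_n}.
Context (l_gt0 : 0 < l) (l_lt1 : l < 1) (Phi_bij : bijective Phi).
Context (Phi_mean : forall T S : 'M[C]_n,
  unitarily_similar (power_mean l (Phi T *m Phi S)) (Phi (power_mean l (T *m S)))).

Lemma mean_preserver_surj Y : exists X, Phi X = Y.
Proof. by have [Psi _ PsiK] := Phi_bij; exists (Psi Y). Qed.

Lemma mean_preserver0 : Phi 0 = 0.
Proof.
have [S S0] := mean_preserver_surj 0.
apply: unitarily_similar0; apply: unitarily_similar_sym.
by have := Phi_mean 0 S; rewrite S0 mulmx0 mul0mx power_mean0.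
Qed.

(** P vanishes only at 0, and Phi fixes 0. Read in either direction, (ii) therefore transfers the
    vanishing of a product. *)
Lemma mean_preserver_mul0 T S : T *m S = 0 -> Phi T *m Phi S = 0.
Proof.
move=> TS; apply: (@power_mean_eq0 _ _ l); rewrite ?ltW //.
apply: unitarily_similar0; rewrite -mean_preserver0 -(power_mean0 _ l) -TS.
exact: Phi_mean.
Qed.

Lemma mean_preserver_mul0_inv T S : Phi T *m Phi S = 0 -> T *m S = 0.
Proof.
move=> TS; apply: (@power_mean_eq0 _ _ l); rewrite ?ltW //.
apply: (bij_inj Phi_bij); rewrite mean_preserver0.
apply/unitarily_similar0/unitarily_similar_sym; rewrite -(power_mean0 _ l) -TS.
exact: Phi_mean.
Qed.

Lemma mean_preserver_tr T S :
  \tr (Phi T *m Phi S) = \tr (Phi (power_mean l (T *m S))).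
Proof. by rewrite -(unitarily_similar_tr (Phi_mean T S)) mxtrace_power_mean. Qed.

(** The orthogonal projection onto the complement of x. At x = 0 the convention 0^-1 = 0 makes it
    the identity, so the two facts below hold there as well. *)
Let Zproj (x : 'cV[C]_n) : 'M_n := 1%:M - (dot x x)^-1 *: outer x x.

Let Zproj_col x : Zproj x *m x = 0.
Proof.
have [->|/dot_gt0 x0] := eqVneq x 0; first by rewrite mulmx0.
rewrite mulmxBl mul1mx -scalemxAl mul_outer_col scalerA mulVf ?gt_eqF //.
by rewrite scale1r subrr.
Qed.

Let Zproj_eq0 x (M : 'M[C]_n) : Zproj x *m M = 0 ->
  M = outer x ((dot x x)^-1 *: (M^t* *m x)).
Proof.
rewrite mulmxBl mul1mx => /eqP; rewrite subr_eq0 => /eqP {1}->.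
rewrite outerZr conj_Creal ?ger0_real ?invr_ge0 ?dot_ge0 //.
by rewrite -scalemxAl /outer trmxC_mul trmxCK mulmxA.
Qed.

(* X has rank at most one iff every nonzero column of X spans its range, and
   ranges are compared through left annihilators, which Phi preserves. *)
Lemma mean_preserver_rank_le1 X : rank_le1 X -> rank_le1 (Phi X).
Proof.
move=> [x [y XE]]; have [X0|X0] := eqVneq (Phi X) 0.
  by exists 0, 0; rewrite outer0l.
have [j Xj] : exists j, col j (Phi X) != 0.
  apply/existsP; apply: contraNT X0; rewrite negb_exists => /forallP X0.
  apply/eqP/matrixP => i j; have := X0 j; rewrite negbK => /eqP/colP/(_ i).
  by rewrite !mxE.
set a := col j (Phi X) in Xj.
(* Phi(Y) has range spanned by the column [a], and Phi(Z) annihilates exactly that range. *)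
have [Y YE] := mean_preserver_surj (outer a a).
have [Z ZE] := mean_preserver_surj (Zproj a).
have XY W : Phi W *m Phi X = 0 -> Phi W *m Phi Y = 0.
  move=> WX; rewrite YE /outer mulmxA {1}/a colE [Phi W *m (_ *m _)]mulmxA WX.
  by rewrite !mul0mx.
have XY' (W : 'M[C]_n) : W *m X = 0 -> W *m Y = 0.
  by move=> WX; apply/mean_preserver_mul0_inv/XY/mean_preserver_mul0.
have YE' : Y = outer x ((dot x x)^-1 *: (Y^t* *m x)).
  by apply/Zproj_eq0/XY'; rewrite XE /outer mulmxA Zproj_col mul0mx.
set w := _ *: _ in YE'.
have Y0 : Y != 0.
  apply: contra Xj => /eqP Y0; apply/eqP/dot_eq0.
  by rewrite -mxtrace_outer -YE Y0 mean_preserver0 linear0.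
have [k wk] : exists k, (w^t* 0 k) != 0.
  apply/existsP; apply: contraNT Y0; rewrite negb_exists => /forallP w0.
  rewrite YE' /outer (_ : w^t* = 0) ?mulmx0 //; apply/rowP => i.
  by have := w0 i; rewrite negbK => /eqP ->; rewrite mxE.
(* Column [k] of [Z *m Y] is [Z *m x] times a nonzero scalar, so Z annihilates x and with it X. *)
have ZX : Z *m X = 0.
  have : Z *m Y = 0.
    apply/mean_preserver_mul0_inv; rewrite ZE YE /outer mulmxA Zproj_col mul0mx //.
  rewrite YE' XE /outer !mulmxA => /(congr1 (fun M => col k M)) ZY.
  rewrite (_ : Z *m x = 0) ?mul0mx //; apply/colP => i; apply/eqP.
  have /colP/(_ i)/eqP := ZY; rewrite col0 mxE [X in _ == X]mxE mxE big_ord1.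
  by rewrite mulf_eq0 (negPf wk) orbF => /eqP ->; rewrite mxE.
exists a, ((dot a a)^-1 *: ((Phi X)^t* *m a)); apply: Zproj_eq0.
by rewrite -ZE; apply/mean_preserver_mul0.
Qed.

(* Taking T = S = p, traces give Phi(p) = (u + z) u^* with u a unit vector and z
   orthogonal to u; P shrinks z strictly, so equality of Frobenius norms gives
   z = 0. *)
Lemma mean_preserver_proj x : dot x x = 1 ->
  exists2 u, dot u u = 1 & Phi (outer x x) = outer u u.
Proof.
move=> xx; set p := outer x x; have PhiI := bij_inj Phi_bij.
have pp : p *m p = p by rewrite mul_outer xx scale1r.
have p0 : p != 0.
  apply/eqP => /(congr1 mxtrace)/eqP.
  by rewrite mxtrace_outer xx linear0 oner_eq0.
have Fp0 : Phi p != 0 by rewrite -mean_preserver0 (inj_eq PhiI).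
have p1 : rank_le1 p by exists x, x.
have [w [u [uu FE]]] := rank_le1_unit Fp0 (mean_preserver_rank_le1 p1).
exists u => //; rewrite FE.
have FF : Phi p *m Phi p = dot u w *: Phi p by rewrite FE mul_outer.
have Pp : power_mean l (p *m p) = p by rewrite pp -[p]scale1r power_mean_proj.
(* The trace identity reads <u, w>^2 = <u, w>, and <u, w> = 0 would force p p = 0. *)
have c1 : dot u w = 1.
  have := mean_preserver_tr p p; rewrite Pp FF linearZ /= {2}FE FE !mxtrace_outer.
  have c0 : dot u w != 0.
    apply: contra p0 => /eqP c0; apply/eqP; rewrite -pp.
    apply: mean_preserver_mul0_inv.
    by rewrite FF c0 scale0r.
  by move=> /(canRL (mulfK c0)) ->; rewrite divff.
have := unitarily_similar_gram (Phi_mean p p).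
rewrite Pp FF c1 scale1r FE power_mean_outer // c1 mulr1 -!outerZl -outerDl.
rewrite !trmxC_outer !mul_outer !linearZ /= !mxtrace_outer uu !mulr1.
set k := (1 - l) ^+ 2.
have [z wE] : exists z, w = u + z by exists (w - u); rewrite addrC subrK.
have uz : dot u z = 0.
  by apply: (addrI (dot u u)); rewrite -dotDr -wE c1 uu addr0.
have zu : dot z u = 0 by rewrite dotC uz conjC0.
have k0 : 0 <= k by rewrite exprn_ge0 // subr_ge0 ltW.
have k1 : k < 1.
  by rewrite expr_lt1 ?subr_ge0 ?ltW // ltrBlDr ltrDl.
rewrite wE (_ : k *: (u + z) + _ = u + k *: z); last first.
  by rewrite scalerDr addrAC -scalerDl [k + _]addrC subrK scale1r.
rewrite !(dotDl, dotDr, dotZl, dotZr) uz zu uu !(mulr0, addr0, add0r).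
rewrite conj_Creal ?ger0_real // => /addrI/eqP.
rewrite -subr_eq0 mulrA -{2}[dot z z]mul1r -mulrBl mulf_eq0 => /orP[|/eqP].
  by rewrite subr_eq0 -expr2 lt_eqF // expr_lt1.
by move=> /dot_eq0 ->; rewrite addr0.
Qed.

(** Since additivity of Phi is unknown, a preimage Z of 1 - Phi(p) stands in for 1 - p. Zero
    products give Z p = 0, hence Z X = Z p X = 0. *)
Lemma mean_preserver_absorbl p X :
  Phi p *m Phi p = Phi p -> p *m X = X -> Phi p *m Phi X = Phi X.
Proof.
move=> pp pX; have [Z ZE] := mean_preserver_surj (1%:M - Phi p).
have ZX : Z *m X = 0.
  rewrite -pX mulmxA (_ : Z *m p = 0) ?mul0mx //; apply/mean_preserver_mul0_inv.
  by rewrite ZE mulmxBl mul1mx pp subrr.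
have /mean_preserver_mul0 := ZX; rewrite ZE mulmxBl mul1mx => /eqP.
by rewrite subr_eq0 => /eqP.
Qed.

Lemma mean_preserver_absorbr p X :
  Phi p *m Phi p = Phi p -> X *m p = X -> Phi X *m Phi p = Phi X.
Proof.
move=> pp pX; have [Z ZE] := mean_preserver_surj (1%:M - Phi p).
have ZX : X *m Z = 0.
  rewrite -pX -mulmxA (_ : p *m Z = 0) ?mulmx0 //; apply/mean_preserver_mul0_inv.
  by rewrite ZE mulmxBr mulmx1 pp subrr.
have /mean_preserver_mul0 := ZX; rewrite ZE mulmxBr mulmx1 => /eqP.
by rewrite subr_eq0 => /eqP.
Qed.

Let proj_idem x : dot x x = 1 ->
  Phi (outer x x) *m Phi (outer x x) = Phi (outer x x).
Proof.
by move=> /mean_preserver_proj[u uu ->]; rewrite mul_outer uu scale1r.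
Qed.

(** Phi(x x^* ) can be inserted on the left and moved to the right under the trace. The product
    inside P becomes <y, x> x x^*, which P fixes. *)
Lemma mean_preserver_tr_outerl x y : dot x x = 1 ->
  \tr (Phi (outer x y)) = \tr (Phi (dot y x *: outer x x)).
Proof.
move=> xx.
rewrite -{1}(@mean_preserver_absorbl (outer x x)) ?proj_idem //; last first.
  by rewrite mul_outer xx scale1r.
by rewrite mxtrace_mulC mean_preserver_tr mul_outer power_mean_proj.
Qed.

Lemma mean_preserver_tr_outerr x y : dot y y = 1 ->
  \tr (Phi (outer x y)) = \tr (Phi (dot y x *: outer y y)).
Proof.
move=> yy.
rewrite -{1}(@mean_preserver_absorbr (outer y y)) ?proj_idem //; last first.
  by rewrite mul_outer yy scale1r.
by rewrite mxtrace_mulC mean_preserver_tr mul_outer power_mean_proj.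
Qed.

(** For u, v not orthogonal, take a multiple w of v with <w, u> = a. Evaluating the trace of Phi at
    u w^* from the left gives the value for u, from the right the value for v. Orthogonal x, y are
    compared through their normalized sum. *)
Lemma mean_preserver_tr_proj x y a : dot x x = 1 -> dot y y = 1 ->
  \tr (Phi (a *: outer x x)) = \tr (Phi (a *: outer y y)).
Proof.
have nonorth u v : dot u u = 1 -> dot v v = 1 -> dot v u != 0 ->
    \tr (Phi (a *: outer u u)) = \tr (Phi (a *: outer v v)).
  move=> uu vv vu; pose w := (a / dot v u)^* *: v.
  have wu : dot w u = a by rewrite dotZl conjCK divfK.
  rewrite -{1}wu -mean_preserver_tr_outerl // outerZr conjCK -outerZl.
  by rewrite mean_preserver_tr_outerr // dotZr divfK.
move=> xx yy; have [yx|] := eqVneq (dot y x) 0; last exact: nonorth.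
have xy : dot x y = 0 by rewrite dotC yx conjC0.
have xy0 : x + y != 0.
  apply/eqP => /(congr1 (dot x))/eqP.
  by rewrite dotDr xx xy addr0 /dot mulmx0 mxE oner_eq0.
have [c [z [c0 zz xyE]]] := unit_normalize xy0.
have zE : z = c^-1 *: (x + y) by rewrite xyE scalerA mulVf ?gt_eqF ?scale1r.
rewrite (nonorth x z) ?(nonorth z y) // zE ?dotZl ?dotZr ?(dotDl, dotDr).
  by rewrite yx yy add0r mulr1 invr_eq0 gt_eqF.
by rewrite yx xx addr0 mulr1 conjC_eq0 invr_eq0 gt_eqF.
Qed.

Lemma mean_preserver_tr_rank_le1 x X : dot x x = 1 -> rank_le1 X ->
  \tr (Phi X) = \tr (Phi (\tr X *: outer x x)).
Proof.
move=> xx X1; have [->|X0] := eqVneq X 0.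
  by rewrite linear0 scale0r.
have [u [v [vv ->]]] := rank_le1_unit X0 X1.
by rewrite mean_preserver_tr_outerr // mxtrace_outer; apply: mean_preserver_tr_proj.
Qed.

(** This yields the function h: its value at a is the trace of Phi at a x x^*, for any fixed unit
    vector x. *)
Lemma mean_preserver_tr_mul x T Y : dot x x = 1 -> rank_le1 Y ->
  \tr (Phi T *m Phi Y) = \tr (Phi (\tr (T *m Y) *: outer x x)).
Proof.
move=> xx Y1; rewrite mean_preserver_tr (mean_preserver_tr_rank_le1 xx).
  by rewrite mxtrace_power_mean.
exact/power_mean_rank_le1/rank_le1_mull.
Qed.
End MeanPreserver.

(** * From the trace identity to an entrywise ring morphism *)

Section TraceForm.
Set Implicit Arguments.
Unset Strict Implicit.
Context {C : numClosedFieldType} {n : nat}.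
Implicit Types (T S Y : 'M[C]_n) (h : C -> C).

Lemma delta_outer (i j : 'I_n) :
  delta_mx i j = outer (delta_mx i 0) (delta_mx j 0) :> 'M[C]_n.
Proof.
apply/matrixP => a b; rewrite mxE [RHS]mxE big_ord1 !mxE !eqxx !andbT conjC_nat.
by rewrite -natrM mulnb.
Qed.

Lemma dot_delta (i j : 'I_n) :
  dot (delta_mx i 0) (delta_mx j 0) = (i == j)%:R :> C.
Proof.
rewrite /dot mxE (bigD1 i) //= big1 ?addr0 => [|k ki].
  by rewrite !mxE !eqxx !andbT /= conjC1 mul1r.
by rewrite !mxE (negPf ki) conjC0 mul0r.
Qed.

Lemma mul_delta_mxE T (i j : 'I_n) : \tr (T *m delta_mx j i) = T i j.
Proof.
rewrite /mxtrace (bigD1 i) //= big1 ?addr0 => [|k ki].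
  rewrite mxE (bigD1 j) //= big1 ?addr0 => [|m mj]; rewrite mxE.
    by rewrite !eqxx mulr1.
  by rewrite (negPf mj) mulr0.
by rewrite mxE big1 // => m _; rewrite mxE (negPf ki) andbF mulr0.
Qed.

(* Testing against the matrix units gives Psi(T)_ij = h(T_ij) / c_ji; the
   image of the constant projection shows that the matrix 1 / c_ji is of the
   form d_i d_j^* with |d_i| = 1. *)
Lemma trace_form_entrywise h (Psi : 'M[C]_n -> 'M[C]_n) :
  (forall i, Psi (delta_mx i i) = delta_mx i i) ->
  (forall T S, T *m S = 0 -> Psi T *m Psi S = 0) ->
  (forall T Y, rank_le1 Y -> \tr (Psi T *m Psi Y) = h (\tr (T *m Y))) ->
  (forall x, dot x x = 1 -> exists2 v, dot v v = 1 & Psi (outer x x) = outer v v) ->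
  (0 < n)%N ->
  exists2 D : 'M[C]_n, D \is unitarymx &
    forall T, Psi T = D *m map_mx h T *m D^t*.
Proof.
move=> Psid Psi0 Psitr Psiproj n0.
pose c i j := Psi (delta_mx i j) i j.
(* Zero products with the other diagonal units, which [Psi] fixes, kill every entry of the image
   except (i, j). *)
have cE i j : Psi (delta_mx i j) = c i j *: delta_mx i j.
  apply/matrixP => a b; rewrite !mxE.
  have [->|ai] /= := eqVneq a i; last first.
    have : Psi (delta_mx a a) *m Psi (delta_mx i j) = 0.
      by apply: Psi0; rewrite mul_delta_mx_0.
    rewrite Psid => /matrixP/(_ a b); rewrite mulr0 mxE (bigD1 a) //= big1.
      by rewrite !mxE !eqxx mul1r addr0.
    by move=> k /negPf ka; rewrite mxE ka andbF mul0r.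
  have [->|bj] := eqVneq b j; first by rewrite mulr1.
  have : Psi (delta_mx i j) *m Psi (delta_mx b b) = 0.
    by apply: Psi0; rewrite mul_delta_mx_0 // eq_sym.
  rewrite Psid => /matrixP/(_ i b); rewrite mulr0 mxE (bigD1 b) //= big1.
    by rewrite !mxE !eqxx mulr1 addr0.
  by move=> k /negPf kb; rewrite mxE kb mulr0.
have PsiE T i j : c j i * Psi T i j = h (T i j).
  rewrite -[T i j]mul_delta_mxE -Psitr; last first.
    by exists (delta_mx j 0), (delta_mx i 0); rewrite delta_outer.
  by rewrite cE -scalemxAr linearZ /= mul_delta_mxE.
have ci i : c i i = 1 by rewrite /c Psid mxE !eqxx.
(* The vector with all coordinates [s] is a unit vector, and its projection has all entries equal to
   [s ^+ 2]. *)
pose s : C := (sqrtC n%:R)^-1.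
have n0' : (n%:R : C) != 0 by rewrite pnatr_eq0 -lt0n.
have ss : s^* = s by rewrite conj_Creal // ger0_real // invr_ge0 sqrtC_ge0 ler0n.
have [|v vv vE] := Psiproj (const_mx s).
  rewrite /dot mxE (eq_bigr (fun=> s ^+ 2)) => [|i _]; last by rewrite !mxE ss.
  by rewrite sumr_const card_ord /s exprVn sqrtCK -[_^-1 *+ n]mulr_natr mulVf.
pose r := h (s ^+ 2).
have rE i j : r = c j i * (v i 0 * (v j 0)^*).
  have := PsiE (outer (const_mx s) (const_mx s)) i j; rewrite vE.
  by rewrite /outer !mxE !big_ord1 !mxE ss -expr2.
have vr i : v i 0 * (v i 0)^* = r by rewrite (rE i i) ci mul1r.
have r0 : r != 0.
  apply: contra (unit_neq0 vv) => /eqP r0; apply/eqP/colP => i.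
  by apply/eqP; rewrite [X in _ == X]mxE -mul_conjC_eq0 vr r0.
have r_ge0 : 0 <= r by rewrite -(vr (Ordinal n0)) mul_conjC_ge0.
have rr : ((sqrtC r)^-1)^* = (sqrtC r)^-1.
  by rewrite conj_Creal // ger0_real // invr_ge0 sqrtC_ge0.
have r1 a b : (sqrtC r)^-1 * a * ((sqrtC r)^-1 * b) = r^-1 * (a * b).
  by rewrite mulrACA -invfM -expr2 sqrtCK.
(* By [vr] every coordinate of [v] has squared modulus [r], so dividing by the root of [r] gives a
   unimodular diagonal. *)
exists (diag_mx ((sqrtC r)^-1 *: v^T)).
  apply/unitarymxP/matrixP => i j.
  rewrite mul_diag_mx !mxE eq_sym; case: eqP => [->|_].
    by rewrite !mulr1n rmorphM /= rr r1 vr mulVf.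
  by rewrite rmorph0 mulr0.
move=> T; apply/matrixP => i j.
have -> : (diag_mx ((sqrtC r)^-1 *: v^T))^t*
    = diag_mx (map_mx conjC ((sqrtC r)^-1 *: v^T)).
  by rewrite tr_diag_mx map_diag_mx.
rewrite mul_mx_diag mul_diag_mx !mxE rmorphM /= rr -PsiE.
transitivity ((sqrtC r)^-1 * v i 0 * ((sqrtC r)^-1 * (v j 0)^*)
  * (c j i * Psi T i j)); last by ring.
rewrite r1 -mulrA (_ : _ * (c j i * _) = r * Psi T i j).
  by rewrite mulrA mulVf ?mul1r.
by rewrite (rE i j); ring.
Qed.

(** The row (a, b) times the column (c, d), placed at the indices i and j, has trace a c + b d. As h
    fixes 0, applying h entrywise keeps this shape. *)
Lemma trace_form_additive h (i j : 'I_n) : i != j -> h 0 = 0 ->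
  (forall T Y, rank_le1 Y ->
    \tr (map_mx h T *m map_mx h Y) = h (\tr (T *m Y))) ->
  forall a b c d : C, h (a * c + b * d) = h a * h c + h b * h d.
Proof.
move=> ij h0 trE a b c d.
have tr2 x y z t : \tr ((x *: delta_mx i i + y *: delta_mx i j)
    *m (z *: delta_mx i i + t *: delta_mx j i)) = x * z + y * t :> C.
  rewrite mulmxDl !mulmxDr -!scalemxAr !linearD !linearZ /= !mul_delta_mxE !mxE.
  by rewrite !eqxx [j == i]eq_sym (negPf ij) /=; ring.
rewrite -2!tr2 -trE; last first.
  exists (c *: delta_mx i 0 + d *: delta_mx j 0), (delta_mx i 0).
  by rewrite outerDl !outerZl -!delta_outer.
congr (\tr (_ *m _)); apply/matrixP => k m; rewrite !mxE.
  have [_|_] := eqVneq k i; last by rewrite !mulr0 addr0 h0.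
  have [->|_] := eqVneq m i; first by rewrite (negPf ij) !mulr0 !mulr1 !addr0.
  by case: eqP => _; rewrite !mulr0 ?mulr1 !add0r ?h0.
have [_|_] := eqVneq m i; last by rewrite !andbF !mulr0 addr0 h0.
have [->|_] := eqVneq k i; first by rewrite (negPf ij) !mulr0 !mulr1 !addr0.
by case: eqP => _; rewrite !mulr0 ?mulr1 !add0r ?h0.
Qed.

(** The projection onto the span of e_i + a e_j has entries e, e a and e a^* at (i, i), (j, i) and
    (i, j). Hermitian symmetry of its image makes h(e) real and, after cancelling h(e), relates h(a)
    to h(a^* ). *)
Lemma trace_form_conj h (i j : 'I_n) : i != j ->
  {morph h : a b / a * b} -> h 1 = 1 ->
  (forall x : 'cV[C]_n, dot x x = 1 ->
    (map_mx h (outer x x))^t* = map_mx h (outer x x)) ->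
  {morph h : a / a^*}.
Proof.
move=> ij hM h1 hherm a; set x : 'cV[C]_n := delta_mx i 0 + a *: delta_mx j 0.
have x0 : x != 0.
  apply/eqP => /colP/(_ i)/eqP.
  by rewrite !mxE !eqxx (negPf ij) mulr0 addr0 oner_eq0.
have xi : x i 0 = 1 by rewrite !mxE !eqxx (negPf ij) mulr0 addr0.
have xj : x j 0 = a by rewrite !mxE !eqxx [j == i]eq_sym (negPf ij) mulr1 add0r.
clearbody x; have [c [u [c0 uu xE]]] := unit_normalize x0.
set e := c^-1 * c^-1.
have uE k : u k 0 = c^-1 * x k 0 by rewrite xE mxE mulrA mulVf ?gt_eqF ?mul1r.
have ouE k m : outer u u k m = e * (x k 0 * (x m 0)^*).
  rewrite /outer mxE big_ord1 !mxE !uE rmorphM /= conj_Creal ?gtr0_real ?invr_gt0 //.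
  by rewrite mulrACA.
have hu k m : (h (outer u u m k))^* = h (outer u u k m).
  by have /matrixP/(_ k m) := hherm u uu; rewrite !mxE.
have e0 : e != 0 by rewrite mulf_neq0 ?invr_eq0 ?gt_eqF.
clearbody e; have := hu i i; have := hu i j; rewrite !ouE xi xj conjC1 !mulr1 mul1r.
rewrite !hM rmorphM /= => hij eR; rewrite eR in hij.
have he : h e != 0.
  apply/eqP => he; have := hM e e^-1.
  rewrite divff // h1 he mul0r => /eqP.
  by rewrite oner_eq0.
by move/(mulfI he): hij => <-.
Qed.
End TraceForm.

(** * The entrywise form of Phi up to a unitary similarity *)

Section MeanPreserverForm.
Set Implicit Arguments.
Unset Strict Implicit.
Context {C : numClosedFieldType} {n : nat} {l : C} {Phi : 'M[C]_n -> 'M[C]_n}.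
Context (l_gt0 : 0 < l) (l_lt1 : l < 1) (Phi_bij : bijective Phi).
Context (Phi_mean : forall T S : 'M[C]_n,
  unitarily_similar (power_mean l (Phi T *m Phi S)) (Phi (power_mean l (T *m S)))).

Let Phi_proj := mean_preserver_proj l_gt0 l_lt1 Phi_bij Phi_mean.
Let Phi_mul0 := mean_preserver_mul0 l_gt0 l_lt1 Phi_bij Phi_mean.

(** The images of the diagonal units are rank one projections u_i u_i^* with zero mutual products,
    so the u_i are orthonormal and form the columns of U. *)
Lemma mean_preserver_basis : exists2 U : 'M[C]_n, U \is unitarymx &
  forall i, Phi (delta_mx i i) = U *m delta_mx i i *m U^t*.
Proof.
have /choice[u uP] i : exists u, dot u u = 1 /\ Phi (delta_mx i i) = outer u u.
  have [|u uu uE] := @Phi_proj (delta_mx i 0); first by rewrite dot_delta eqxx.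
  by exists u; rewrite delta_outer.
have uu i j : dot (u i) (u j) = (i == j)%:R.
  have [<-|ij] := eqVneq i j; first by case: (uP i).
  have := @Phi_mul0 (delta_mx i i) (delta_mx j j).
  rewrite mul_delta_mx_0 // => /(_ erefl); rewrite (uP i).2 (uP j).2 mul_outer.
  move=> /(congr1 mxtrace); rewrite linearZ /= mxtrace_outer linear0 (dotC (u j)).
  by move=> /eqP; rewrite mul_conjC_eq0 => /eqP.
set U : 'M[C]_n := \matrix_(a, i) u i a 0.
have colU i : col i U = u i by apply/colP => a; rewrite !mxE.
exists U => [|i].
  rewrite -trmxC_unitary; apply/unitarymxP; rewrite trmxCK.
  apply/matrixP => i j; rewrite [RHS]mxE -uu /dot !mxE.
  by apply: eq_bigr => k _; rewrite !mxE.
rewrite (uP i).2 delta_outer /outer mulmxA -colE colU -mulmxA.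
by congr (_ *m _); rewrite -trmxC_mul -colE colU.
Qed.

Lemma mean_preserver_entrywise (i j : 'I_n) : i != j ->
  exists h : C -> C, exists2 U : 'M[C]_n, U \is unitarymx &
    [/\ h 1 = 1, {morph h : a b / a + b}, {morph h : a b / a * b},
        {morph h : a / a^*} & forall T, Phi T = U *m map_mx h T *m U^t*].
Proof.
move=> ij; have [V VU VE] := mean_preserver_basis.
have VV := unitarymx_trmxCK VU.
have ii : dot (delta_mx i 0) (delta_mx i 0) = 1 :> C by rewrite dot_delta eqxx.
pose h a := \tr (Phi (a *: outer (delta_mx i 0) (delta_mx i 0))).
(* After this change of basis the diagonal matrix units are fixed. *)
pose Psi T := V^t* *m Phi T *m V.
have PsiM T S : Psi T *m Psi S = V^t* *m (Phi T *m Phi S) *m V.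
  by rewrite /Psi !mulmxA -[_ *m V *m V^t*]mulmxA (unitarymxP VU) mulmx1.
have Psitr T Y : rank_le1 Y -> \tr (Psi T *m Psi Y) = h (\tr (T *m Y)).
  move=> Y1; rewrite PsiM mxtrace_mulC !mulmxA (unitarymxP VU) mul1mx.
  exact: (mean_preserver_tr_mul l_gt0 l_lt1 Phi_bij Phi_mean).
have Psiproj x : dot x x = 1 -> exists2 v, dot v v = 1 & Psi (outer x x) = outer v v.
  move=> /Phi_proj[u uu uE]; exists (V^t* *m u).
    by rewrite /dot trmxC_mul trmxCK mulmxA (mulmxtVK _ VU).
  by rewrite /Psi uE /outer trmxC_mul trmxCK !mulmxA.
have h0 : h 0 = 0.
  by rewrite /h scale0r (mean_preserver0 Phi_bij Phi_mean) linear0.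
have h1 : h 1 = 1.
  by rewrite /h scale1r; have [u uu ->] := Phi_proj ii; rewrite mxtrace_outer.
have [|||D DU DE] := @trace_form_entrywise _ _ h Psi _ _ Psitr Psiproj.
- by move=> k; rewrite /Psi VE !mulmxA VV mul1mx -mulmxA VV mulmx1.
- by move=> T S TS; rewrite PsiM Phi_mul0 // mulmx0 mul0mx.
- exact: leq_ltn_trans (ltn_ord i).
have DD := unitarymx_trmxCK DU.
have hE T : map_mx h T = D^t* *m Psi T *m D.
  by rewrite DE !mulmxA DD mul1mx -mulmxA DD mulmx1.
have hadd := @trace_form_additive _ _ h i j ij h0.
have {}hadd a b c d : h (a * c + b * d) = h a * h c + h b * h d.
  apply: hadd => T Y Y1; rewrite -Psitr // !hE !mulmxA.
  rewrite -[_ *m D *m D^t*]mulmxA (unitarymxP DU) mulmx1 -!mulmxA mxtrace_mulC.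
  by rewrite -!mulmxA (unitarymxP DU) mulmx1.
(* Multiplicativity is [hadd] with both second terms 0; additivity, below, is [hadd] with c = d =
   1. *)
have hM : {morph h : a b / a * b}.
  by move=> a b; have := hadd a 0 b 0; rewrite mul0r h0 mul0r !addr0.
exists h, (V *m D); first by rewrite mul_unitarymx.
split=> // [a b||T].
- by have := hadd a b 1 1; rewrite h1 !mulr1.
- apply: (@trace_form_conj _ _ h i j ij hM h1) => x /Psiproj[v _ vE].
  by rewrite hE vE trmxC_mul trmxC_mul trmxCK trmxC_outer mulmxA.
rewrite hE trmxC_mul /Psi !mulmxA -[V *m D *m D^t*]mulmxA (unitarymxP DU) mulmx1.
rewrite (unitarymxP VU) mul1mx -!mulmxA [D *m _]mulmxA (unitarymxP DU) mul1mx.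
by rewrite (unitarymxP VU) mulmx1.
Qed.
End MeanPreserverForm.

Local Open Scope complex_scope.

(** * Ring morphisms of the complex numbers commuting with conjugation *)

Section ComplexAutomorphisms.
Set Implicit Arguments.
Unset Strict Implicit.
Context {R : realType}.

(** Squares go to squares, so f is monotone; it also fixes the rationals. A rational strictly
    between f(x) and x would contradict this. *)
Lemma real_rmorphism_id (f : {rmorphism R -> R}) : f =1 id.
Proof.
have f_ge0 x : 0 <= x -> 0 <= f x.
  by move=> x0; rewrite -(sqr_sqrtr x0) rmorphXn sqr_ge0.
have f_le x y : x <= y -> f x <= f y.
  by rewrite -subr_ge0 => /f_ge0; rewrite rmorphB subr_ge0.
move=> x /=; have [fx|fx|//] := ltgtP (f x) x; have [q] := rat_in_itvoo fx;
  rewrite in_itv /= => /andP[]; rewrite -{1 2}(fmorph_rat f q) => q1 q2.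
- by have := f_le _ _ (ltW q2); rewrite fmorph_rat leNgt q1.
- by have := f_le _ _ (ltW q1); rewrite fmorph_rat leNgt q2.
Qed.

(** Commuting with conjugation, h maps reals to reals and restricts to a ring endomorphism of R,
    which is the identity. What remains is the choice of h(i) among the two square roots of -1. *)
Lemma complex_conj_morphism_id_conj (h : R[i] -> R[i]) :
  h 1 = 1 -> {morph h : a b / a + b} -> {morph h : a b / a * b} ->
  {morph h : a / conjC a} -> h =1 id \/ h =1 conjC.
Proof.
move=> h1 hD hM hC.
have h_real (x : R) : h x%:C = (complex.Re (h x%:C))%:C.
  rewrite RRe_real //; apply/CrealP; rewrite -hC; congr h.
  by apply/CrealP/complex_realP; exists x.
pose k (x : R) : R := complex.Re (h x%:C).
have h0 : h 0 = 0 by apply: (addrI (h 0)); rewrite -hD !addr0.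
have hN a : h (- a) = - h a.
  by apply: (addrI (h a)); rewrite -hD !subrr.
have kB : zmod_morphism k.
  move=> x y; apply: (@complexI R).
  by rewrite -h_real !rmorphB /= -!h_real hD hN.
have kM : monoid_morphism k.
  split=> [|x y]; apply: (@complexI R); first by rewrite -h_real h1.
  by rewrite -h_real !rmorphM /= -!h_real hM.
pose k1 := GRing.isZmodMorphism.Build R R k kB.
pose k2 := GRing.isMonoidMorphism.Build R R k kM.
pose kR : {rmorphism R -> R} := HB.pack k k1 k2.
have {}h_real (x : R) : h x%:C = x%:C.
  by rewrite h_real -[LHS]/((kR x)%:C) real_rmorphism_id.
have : h 'i%C * h 'i%C = 'i%C * 'i%C.
  by rewrite -hM -expr2 sqr_i hN h1.
move=> /eqP; rewrite -!expr2 eqf_sqr => /orP[]/eqP hi; [left|right] => z.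
  by rewrite [z in LHS]complexE hD hM !h_real hi -complexE.
rewrite [z in LHS]complexE hD hM !h_real hi; case: z => a b.
apply/eqP; rewrite eq_complex /=.
by rewrite !(mul0r, mulr0, subr0, addr0, add0r, oppr0, mulN1r) !eqxx.
Qed.
End ComplexAutomorphisms.

(** * The equivalence of the three conditions *)

Theorem theorem4p1 (R : realType) (n : nat) (lambda : R)
    (Phi : 'M[R[i]]_n -> 'M[R[i]]_n) :
  (2 <= n)%N -> 0 < lambda -> lambda < 1 -> bijective Phi ->
  [<->
    (* (i) *)
    forall T S : 'M[R[i]]_n,
      power_mean lambda%:C (Phi T *m Phi S)
      = Phi (power_mean lambda%:C (T *m S));
    (* (ii) *)
    forall T S : 'M[R[i]]_n,
      unitarily_similar (power_mean lambda%:C (Phi T *m Phi S))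
                        (Phi (power_mean lambda%:C (T *m S)));
    (* (iii) *)
    exists2 U : 'M[R[i]]_n, U \is unitarymx &
      (forall T, Phi T = U *m T *m U^t*)
      \/ (forall T, Phi T = U *m map_mx conjC T *m U^t*)].
Proof.
move=> n2 l0 l1 Phi_bij; set l := lambda%:C.
have lR : l \is Num.real by apply/complex_realP; exists lambda.
tfae=> [PM T S|PM|[U UU PhiE] T S].
- by rewrite PM; exists 1%:M; first apply/unitarymxP; rewrite trmxC1 mul1mx ?mulmx1.
- have ij : Ordinal (ltnW n2) != Ordinal n2 by [].
  have [||h [U UU [h1 hD hM hC PhiE]]] :=
    mean_preserver_entrywise _ _ Phi_bij PM ij; rewrite ?ltcR //.
  exists U => //.
  have [hE|hE] := complex_conj_morphism_id_conj h1 hD hM hC; [left|right] => T.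
    by rewrite PhiE; congr (_ *m _ *m _); apply/matrixP => a b; rewrite mxE hE.
  by rewrite PhiE; congr (_ *m _ *m _); apply/matrixP => a b; rewrite !mxE hE.
have UVU := unitarymx_trmxCK UU.
(* Both forms in (iii) are covered at once, with [s] the identity or the entrywise conjugation.
   Homogeneity over real scalars suffices because the weights in P are real. *)
have conjM (s : 'M[R[i]]_n -> 'M[R[i]]_n) : {morph s : A B / A *m B} ->
    {morph s : A / A^t*} -> {morph s : A B / A + B} ->
    (forall c A, c \is Num.real -> s (c *: A) = c *: s A) ->
    (forall T, Phi T = U *m s T *m U^t*) ->
    power_mean l (Phi T *m Phi S) = Phi (power_mean l (T *m S)).
  move=> sM sC sD sZ {}PhiE.
  have PhiM : {morph Phi : A B / A *m B}.
    by move=> A B; rewrite !PhiE sM !mulmxA (mulmxKtV _ UU).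
  rewrite -PhiM; apply/esym/power_mean_morph => // [A|A B|c A cR].
  - by rewrite !PhiE sC !trmxC_mul trmxCK mulmxA.
  - by rewrite !PhiE sD mulmxDr mulmxDl.
  - by rewrite !PhiE sZ // -scalemxAr -scalemxAl.
case: PhiE; first exact: (conjM id).
apply: conjM => [A B|A|A B|c A cR]; first exact: map_mxM.
- by apply/matrixP => a b; rewrite !mxE.
- exact: map_mxD.
- by rewrite map_mxZ; congr (_ *: _); apply: conj_Creal.
Qed.
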